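(* Let $\Gamma$ be a distance-regular graph on $n$ vertices, with at least one edge, with distinct adjacency eigenvalues $\theta_0>\theta_1>\cdots>\theta_d$. For $0\le j\le d$ let $\pi_j=\prod_{k=0,\,k\ne j}^{d}|\theta_j-\theta_k|$, and let $m(\theta_i)$ denote the multiplicity of $\theta_i$. Then there is an odd index $i$, $1\le i\le d$, such that $$m(\theta_i)\le \frac{\pi_0}{\pi_i}\left(\frac{2n}{\sum_{j=0}^d\frac{\pi_0}{\pi_j}}-1\right).$$
   Context: Graphs are finite and simple; a distance-regular graph is connected, and its diameter equals $d$ when it has $d+1$ distinct eigenvalues. *)

(* Defs.v *)
From mathcomp Require Import all_boot all_order all_algebra.

Set Implicit Arguments.
Unset Strict Implicit.
Unset Printing Implicit Defensive.

Import Order.TTheory GRing.Theory Num.Theory.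

Definition simple_graph (T : finType) (e : rel T) : Prop :=
  symmetric e /\ irreflexive e.

Definition connected_graph (T : finType) (e : rel T) : Prop :=
  forall x y : T, connect e x y.

Definition walkb (T : finType) (e : rel T) (k : nat) (x y : T) : bool :=
  [exists p : k.-tuple T, path e x p && (last x p == y)].

(* A shortest walk has fewer than #|T| edges, so searching the lengths below
   #|T| suffices; the value is #|T| exactly when y is not reachable from x. *)
Definition gdist (T : finType) (e : rel T) (x y : T) : nat :=
  find (fun k => walkb e k x y) (iota 0 #|T|).

(* b and c give the intersection array: for x, y at distance i, the vertex y
   has b i neighbours at distance i + 1 from x and c i neighbours at distance
   i - 1 from x (none when i = 0, as the successor is on the left below). *)
Definition distance_regular (T : finType) (e : rel T) : Prop :=
  [/\ simple_graph e, connected_graph e &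
      exists b c : nat -> nat, forall x y : T,
        #|[set z | e y z & gdist e x z == (gdist e x y).+1]| = b (gdist e x y)
        /\
        #|[set z | e y z & (gdist e x z).+1 == gdist e x y]| = c (gdist e x y)].

Local Open Scope ring_scope.

Definition adjmx (R : nzRingType) (T : finType) (e : rel T) : 'M[R]_#|T| :=
  \matrix_(i, j) (e (enum_val i) (enum_val j))%:R.

(* Geometric multiplicity; adjacency matrices of graphs are symmetric. *)
Definition multiplicity (F : fieldType) (n : nat) (A : 'M[F]_n) (a : F) : nat :=
  \rank (eigenspace A a).

Definition pi_prod (R : numDomainType) (d : nat) (theta : 'I_d.+1 -> R)
    (j : 'I_d.+1) : R :=
  \prod_(k < d.+1 | k != j) `|theta j - theta k|.

(* Main.v *)
(* Let E_i be the orthogonal projection onto the eigenspace of theta_i, that is,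
   the Lagrange interpolation polynomial of degree d at theta_i evaluated at the
   adjacency matrix A; its leading coefficient is (-1)^i / pi_i.  If x and y are
   at distance d then (A^l)_xy = 0 for l < d, so (E_i)_xy = (-1)^i (A^d)_xy / pi_i,
   and E_0 = J / n turns this into n (E_i)_xy = (-1)^i pi_0 / pi_i.
   - Since E_i is a symmetric idempotent with constant diagonal m(theta_i) / n,
     Cauchy-Schwarz gives pi_0 / pi_i <= m(theta_i) for every even i.
   - Since the E_i add up to the identity matrix, the numbers pi_0 / pi_i have
     the same sum S / 2 over even and over odd indices.
   As the multiplicities add up to n, those of odd index add up to at most
   n - S / 2 = (S / 2) (2 n / S - 1), and some odd i satisfies the claim. *)
Require Import Defs.
From mathcomp Require Import all_boot all_order all_algebra.
From mathcomp Require Import complex ring lra.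
Import Order.TTheory GRing.Theory Num.Theory.
Local Open Scope ring_scope.

Set Implicit Arguments.
Unset Strict Implicit.
Unset Printing Implicit Defensive.

(** * Polynomials and traces of matrices *)

(** Over [R[i]] the matrix becomes Hermitian, hence unitarily diagonalizable with real diagonal; [q]
    acts entrywise on that diagonal, and the result descends along the injection [toC]. *)
Lemma horner_mx_symm (R : rcfType) (n' : nat) (A : 'M[R]_n'.+1)
    (q : {poly R}) :
  A^T = A -> (forall a, eigenvalue A a -> root q a) -> horner_mx A q = 0.
Proof.
move=> symA rootq; pose toC := real_complex R; pose AC := map_mx toC A.
have hermA : AC \is hermsymmx.
  apply: realsym_hermsym.
    by apply/is_hermitianmxP; rewrite expr0 scale1r map_mx_id // map_trmx symA.
  by apply/mxOverP => i j; rewrite mxE; apply/complex_realP; exists (A i j).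
have /orthomx_spectralP := hermitian_normalmx hermA.
have := hermitian_spectral_diag_real hermA.
have := spectral_unit AC.
move: (spectralmx AC) (spectral_diag AC) => P D Punit Dreal defA.
apply: (map_mx_inj (f := toC)); rewrite map_mx0 map_horner_mx -/AC.
rewrite defA horner_mx_uconjC // horner_mx_diag.
suff -> : map_mx (horner (map_poly toC q)) D = 0.
  by rewrite linear0 mulmx0 mul0mx.
apply/rowP => j; rewrite !mxE.
have /complex_realP[a Da] : D 0 j \is Num.real by apply: (mxOverP Dreal).
have : eigenvalue AC (D 0 j).
  apply/eigenvalueP; exists (row j P); last first.
    apply/eqP; rewrite rowE => /(congr1 (mulmx^~ (invmx P))).
    rewrite mulmxK // mul0mx => /matrixP/(_ 0 j)/eqP.
    by rewrite !mxE !eqxx oner_eq0.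
  rewrite defA !mulmxA -row_mul mulmxV // row1 -rowE row_diag_mx -scalemxAl.
  by rewrite -rowE.
(* Being real, the diagonal entry is already an eigenvalue of [A], so [rootq] applies. *)
rewrite Da eigenvalue_root_char -map_char_poly fmorph_root.
rewrite -eigenvalue_root_char => /rootq /rootP qa0.
by rewrite horner_map qa0 rmorph0.
Qed.

(** In a rank factorization [E = C *m R], cancelling [C] on the left and [R] on the right of the
    idempotence relation leaves [R *m C = 1%:M], whose trace is the rank. *)
Lemma mxtrace_idempotent (F : fieldType) (n : nat) (E : 'M[F]_n) :
  E *m E = E -> \tr E = (\rank E)%:R.
Proof.
move=> idE; move: (mulmx_base E) (col_base_full E) (row_base_free E).
move: (col_base E) (row_base E) => C R defE fullC freeR.
suff RC1 : R *m C = 1%:M by rewrite -[X in \tr X]defE mxtrace_mulC RC1 mxtrace1.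
apply: (row_full_inj fullC); apply: (row_free_inj freeR).
by rewrite mulmx1 !mulmxA defE -mulmxA defE.
Qed.

Lemma trmx_exp (R : comNzRingType) (n : nat) (A : 'M[R]_n) (l : nat) :
  (A ^+ l)^T = A^T ^+ l.
Proof.
elim: l => [|l IHl]; first by rewrite !expr0 trmx1.
by rewrite exprSr exprS -IHl [LHS]trmx_mul.
Qed.

(** * Lagrange interpolation and the spectral idempotents *)

Definition lagrange (F : fieldType) (d : nat) (theta : 'I_d.+1 -> F)
    (i : 'I_d.+1) : {poly F} :=
  (\prod_(k < d.+1 | k != i) (theta i - theta k))^-1
    *: \prod_(k < d.+1 | k != i) ('X - (theta k)%:P).

Section Lagrange.
Variables (F : fieldType) (d : nat) (theta : 'I_d.+1 -> F).
Hypothesis theta_inj : injective theta.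

Lemma size_lagrange_numerator (i : 'I_d.+1) :
  size (\prod_(k < d.+1 | k != i) ('X - (theta k)%:P)) = d.+1.
Proof.
rewrite -big_filter size_prod_XsubC size_filter -sum1_count sum1_card.
by rewrite cardC1 card_ord.
Qed.

Lemma size_lagrange (i : 'I_d.+1) : (size (lagrange theta i) <= d.+1)%N.
Proof. by rewrite (leq_trans (size_scale_leq _ _)) ?size_lagrange_numerator. Qed.

Lemma coef_lagrange (i : 'I_d.+1) :
  (lagrange theta i)`_d = (\prod_(k < d.+1 | k != i) (theta i - theta k))^-1.
Proof.
rewrite coefZ.
have /monicP := monic_prod_XsubC (index_enum 'I_d.+1) (fun k => k != i) theta.
rewrite lead_coefE size_lagrange_numerator => ->; exact: mulr1.
Qed.

Lemma horner_lagrange (i j : 'I_d.+1) :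
  (lagrange theta i).[theta j] = (i == j)%:R.
Proof.
rewrite hornerZ horner_prod; have [<-|neq_ij] := eqVneq i j; last first.
  have neq_ji : j != i by rewrite eq_sym.
  by rewrite [X in _ * X](bigD1 j neq_ji) /= hornerXsubC subrr mul0r mulr0.
under [X in _ * X]eq_bigr do rewrite hornerXsubC.
rewrite mulVf //; apply/prodf_neq0 => k neq_ki.
by rewrite subr_eq0 (inj_eq theta_inj) eq_sym.
Qed.

End Lagrange.

(** The sum, idempotence and eigenvalue relations reduce to polynomial identities at the points
    [theta j]. The last clause lets entries of [E i] be read off those of the powers of [A]. *)
Lemma symm_spectral_decomposition (R : rcfType) (n d : nat) (A : 'M[R]_n)
    (theta : 'I_d.+1 -> R) :
  A^T = A -> injective theta ->
  (forall a, eigenvalue A a -> exists i, a = theta i) ->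
  exists E : 'I_d.+1 -> 'M[R]_n,
    [/\ \sum_i E i = 1%:M,
        forall i, E i *m E i = E i,
        forall i, (E i)^T = E i,
        forall i, E i *m A = theta i *: E i &
        forall i, E i = \sum_(l < d.+1) (lagrange theta i)`_l *: A ^+ l].
Proof.
(* [horner_mx_symm] needs positive size; matrices of size zero are all equal. *)
case: n A => [|n] A symA theta_inj spec.
  by exists (fun=> 0); split=> [|i|i|i|i]; apply/matrixP => -[].
have ker q : (forall j, q.[theta j] = 0) -> horner_mx A q = 0.
  by move=> q0; apply: horner_mx_symm => // a /spec[j ->]; apply/rootP.
have sumE i : horner_mx A (lagrange theta i)
    = \sum_(l < d.+1) (lagrange theta i)`_l *: A ^+ l.
  rewrite [in LHS](_ : lagrange theta i
      = \poly_(l < d.+1) (lagrange theta i)`_l); last first.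
    apply/polyP => l; rewrite coef_poly; case: ltnP => // le_dl.
    by rewrite nth_default // (leq_trans (size_lagrange _ _)).
  rewrite poly_def linear_sum; apply: eq_bigr => l _.
  by rewrite linearZ rmorphXn /= horner_mx_X.
exists (fun i => horner_mx A (lagrange theta i)); split=> // [|i|i|i].
- rewrite -[RHS](rmorph1 (horner_mx A)); apply/eqP.
  rewrite -subr_eq0 -rmorph_sum -rmorphB.
  apply/eqP/ker => j; rewrite !hornerE horner_sum (bigD1 j) //= big1 => [|i ne].
    by rewrite horner_lagrange // eqxx addr0 subrr.
  by rewrite horner_lagrange // (negPf ne).
- apply/eqP; rewrite -subr_eq0 -[_ *m _]rmorphM -rmorphB.
  apply/eqP/ker => j; rewrite hornerD hornerN hornerM !horner_lagrange //.
  by case: eqP; rewrite ?mulr1 ?mulr0 subrr.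
- rewrite sumE linear_sum; apply: eq_bigr => l _.
  by rewrite linearZ /= trmx_exp symA.
- apply/eqP; rewrite -subr_eq0 -[X in _ *m X](horner_mx_X A) -[_ *m _]rmorphM.
  rewrite -linearZ -rmorphB; apply/eqP/ker => j.
  rewrite hornerD hornerN hornerM hornerX horner_lagrange //.
  rewrite hornerZ horner_lagrange //.
  by case: eqP => [->|_]; rewrite ?mul1r ?mulr1 ?mul0r ?mulr0 subrr.
Qed.

(** * Walks and graph distance *)

Section Distance.
Variables (T : finType) (e : rel T).
Local Open Scope nat_scope.

Lemma walkb0 (x y : T) : walkb e 0 x y = (x == y).
Proof.
apply/existsP/idP => [[p]|xy]; first by rewrite (tuple0 p).
by exists [tuple].
Qed.

Lemma walkb_rcons (k : nat) (x y z : T) :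
  walkb e k x y -> e y z -> walkb e k.+1 x z.
Proof.
case/existsP => p /andP[pth /eqP lastp] yz; apply/existsP.
have szp : size (rcons p z) == k.+1 by rewrite size_rcons size_tuple.
by exists (Tuple szp); rewrite /= rcons_path last_rcons eqxx pth lastp yz.
Qed.

Lemma gdist_le_card (x y : T) : gdist e x y <= #|T|.
Proof. by rewrite (leq_trans (find_size _ _)) ?size_iota. Qed.

Lemma gdist_walkb (x y : T) : gdist e x y < #|T| -> walkb e (gdist e x y) x y.
Proof.
move=> lt_card; have := nth_find 0 (a := fun k => walkb e k x y).
by move=> /(_ (iota 0 #|T|)); rewrite has_find size_iota nth_iota //; apply.
Qed.

Lemma gdist_le_walkb (k : nat) (x y : T) : walkb e k x y -> gdist e x y <= k.
Proof.
move=> walk; rewrite leqNgt; apply/negP => lt_kd.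
have lt_kn : k < #|T| := leq_trans lt_kd (gdist_le_card x y).
by have := before_find 0 lt_kd; rewrite nth_iota // walk.
Qed.

Lemma gdistxx (x : T) : gdist e x x = 0.
Proof. by apply/eqP; rewrite -leqn0 gdist_le_walkb // walkb0. Qed.

Lemma gdist_eq0 (x y : T) : (gdist e x y == 0) = (x == y).
Proof.
apply/eqP/eqP => [d0|->]; last exact: gdistxx.
have card_gt0 : 0 < #|T| by apply/card_gt0P; exists x.
by apply/eqP; rewrite -walkb0 -d0 gdist_walkb // d0.
Qed.

Lemma gdist_step (x y z : T) : e y z -> gdist e x z <= (gdist e x y).+1.
Proof.
(* An unreachable [y] has the default distance [#|T|], which bounds every value of [gdist]. *)
move=> yz; have := gdist_le_card x y; rewrite leq_eqVlt => /orP[/eqP->|].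
  exact: leq_trans (gdist_le_card x z) (leqnSn _).
by move/gdist_walkb => walk; apply: gdist_le_walkb (walkb_rcons walk yz).
Qed.

End Distance.

Lemma natr_card (R : pzSemiRingType) (I : finType) (P : pred I) :
  #|[set z | P z]|%:R = \sum_z (P z)%:R :> R.
Proof.
rewrite -sum1_card natr_sum big_mkcond; apply: eq_bigr => z _.
by rewrite inE; case: (P z).
Qed.

(** * Powers of the adjacency matrix *)

Section Adjacency.
Variables (R : comNzRingType) (T : finType) (e : rel T).
Let A : 'M[R]_#|T| := adjmx R e.

Lemma sum_enum_rank (F : 'I_#|T| -> R) :
  \sum_i F i = \sum_z F (enum_rank z).
Proof. exact: (reindex _ (onW_bij _ (@enum_rank_bij T))). Qed.

Lemma adjmxE (x y : T) : A (enum_rank x) (enum_rank y) = (e x y)%:R.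
Proof. by rewrite mxE !enum_rankK. Qed.

Lemma adjmx_expSE (l : nat) (x y : T) :
  (A ^+ l.+1) (enum_rank x) (enum_rank y)
    = \sum_z (A ^+ l) (enum_rank x) (enum_rank z) * (e z y)%:R.
Proof.
rewrite exprSr [LHS]mxE sum_enum_rank.
by under eq_bigr do rewrite adjmxE.
Qed.

(** No walk is shorter than the distance: passing from [y] to a vertex adjacent to it lowers the
    distance from [x] by at most one. *)
Lemma adjmx_exp_gdist_lt (l : nat) (x y : T) :
  (l < gdist e x y)%N -> (A ^+ l) (enum_rank x) (enum_rank y) = 0.
Proof.
elim: l y => [|l IHl] y ltd.
  rewrite expr0 mxE (inj_eq enum_rank_inj).
  by rewrite -(gdist_eq0 e) (gtn_eqF ltd).
rewrite adjmx_expSE big1 // => z _; have [ezy|_] := boolP (e z y); last first.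
  exact: mulr0.
by rewrite IHl ?mul0r // -ltnS (leq_trans ltd) // gdist_step.
Qed.

Hypothesis drg : distance_regular e.

(** The valency is [b 0], as every neighbour of [y] lies at distance one from it. *)
Lemma drg_regular : exists k : nat, forall y, #|[set z | e y z]| = k.
Proof.
have [[syme irre] _ [b [c bc]]] := drg; exists (b 0) => y.
have [bE _] := bc y y; rewrite gdistxx in bE; rewrite -bE.
apply: eq_card => z; rewrite !inE.
case: (boolP (e y z)) => //= eyz.
have le1 := gdist_step y eyz; rewrite gdistxx in le1.
have neq_yz : y != z by apply: contraTneq eyz => <-; rewrite irre.
by rewrite eqn_leq le1 lt0n gdist_eq0 neq_yz.
Qed.

(** This places the powers of [A] in the span of the distance matrices: multiplication by [A] acts
    on functions of the distance by a three-term recurrence. *)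
Lemma adjmx_exp_gdist :
  exists f : nat -> nat -> R, forall (l : nat) (x y : T),
    (A ^+ l) (enum_rank x) (enum_rank y) = f l (gdist e x y).
Proof.
have [k degk] := drg_regular.
have [[syme irre] _ [b [c bc]]] := drg.
(* Sum of [g] over the neighbours of a vertex at distance [h]: all [k] are first counted at distance
   [h], then those at [h.+1] and [h.-1] are corrected. At [h = 0] the last term vanishes since
   [h.-1 = h]. *)
pose step (g : nat -> R) h :=
  k%:R * g h + (b h)%:R * (g h.+1 - g h) + (c h)%:R * (g h.-1 - g h).
exists (fun l => iter l step (fun h => (h == 0%N)%:R)); elim=> [|l IHl] x y.
  by rewrite expr0 mxE (inj_eq enum_rank_inj) /= gdist_eq0.
rewrite adjmx_expSE iterS; move: (iter l step _) IHl => g IHl.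
have [bE cE] := bc x y; rewrite /step -bE -cE -(degk y) !natr_card !mulr_suml.
rewrite -!big_split; apply: eq_bigr => z _ /=; rewrite IHl syme.
have [eyz|_] := boolP (e y z); last by rewrite !mul0r mulr0 !addr0.
(* Using the edge in both directions shows that the two distances differ by at most one. *)
have := gdist_step x eyz; rewrite syme in eyz; have := gdist_step x eyz.
move: (gdist e x y) (gdist e x z) => h h' le_hh' le_h'h /=.
rewrite mulr1 mul1r; have [->|ne1] := eqVneq h' h.+1.
  by rewrite gtn_eqF // mul0r addr0 mul1r addrC subrK.
rewrite mul0r addr0; have [<-|ne2] := eqVneq h'.+1 h.
  by rewrite mul1r addrC subrK.
rewrite mul0r addr0; congr g; apply/eqP; rewrite eqn_leq.
rewrite leq_eqVlt eq_sym (negPf ne2) /= in le_hh'.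
rewrite leq_eqVlt (negPf ne1) /= in le_h'h.
by rewrite -ltnS le_h'h.
Qed.

End Adjacency.

(** * The Laplacian form of a regular graph *)

Section Laplacian.
Variables (R : realDomainType) (T : finType) (e : rel T) (k : nat).
Hypotheses (syme : symmetric e) (deg : forall y, #|[set z | e y z]| = k).

(** The left side is twice the Laplacian quadratic form. Regularity and symmetry give the two square
    terms, the eigenvalue equation the cross term. *)
Lemma regular_laplacian (v : T -> R) (a : R) :
  (forall y, \sum_z (e y z)%:R * v z = a * v y) ->
  \sum_y \sum_z (e y z)%:R * (v y - v z) ^+ 2
    = 2 * (k%:R - a) * \sum_y v y ^+ 2.
Proof.
move=> eigv.
have degs y : \sum_z (e y z)%:R = k%:R :> R by rewrite -natr_card deg.
have s1 : \sum_y \sum_z (e y z)%:R * v y ^+ 2 = k%:R * \sum_y v y ^+ 2.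
  by rewrite mulr_sumr; apply: eq_bigr => y _; rewrite -mulr_suml degs.
have s2 : \sum_y \sum_z (e y z)%:R * v z ^+ 2 = k%:R * \sum_y v y ^+ 2.
  by rewrite exchange_big -s1; do 2![apply: eq_bigr => ? _]; rewrite syme.
have s3 : \sum_y \sum_z (e y z)%:R * (v y * v z) = a * \sum_y v y ^+ 2.
  rewrite mulr_sumr; apply: eq_bigr => y _; rewrite expr2 mulrA -eigv.
  by rewrite mulr_suml; apply: eq_bigr => z _; rewrite -mulrA [v z * _]mulrC.
have -> : 2 * (k%:R - a) * \sum_y v y ^+ 2 = k%:R * (\sum_y v y ^+ 2)
  + k%:R * (\sum_y v y ^+ 2) - 2 * (a * \sum_y v y ^+ 2) by ring.
rewrite -{1}s1 -s2 -s3 mulr_sumr -big_split -sumrB; apply: eq_bigr => y _.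
rewrite /= mulr_sumr -big_split -sumrB; apply: eq_bigr => z _ /=; ring.
Qed.

Lemma regular_eigenvalue_le (v : T -> R) (a : R) :
  (forall y, \sum_z (e y z)%:R * v z = a * v y) -> (exists y, v y != 0) ->
  a <= k%:R.
Proof.
move=> eigv [y vy]; rewrite -subr_ge0.
have v2_gt0 : 0 < \sum_y v y ^+ 2.
  rewrite (bigD1 y) //= ltr_pwDl ?exprn_even_gt0 //.
  by apply: sumr_ge0 => ? _; exact: sqr_ge0.
rewrite -(pmulr_lge0 _ v2_gt0) -(pmulr_rge0 _ (ltr0Sn R 1)) mulrA.
rewrite -regular_laplacian //; do 2![apply: sumr_ge0 => ? _].
by rewrite mulr_ge0 ?sqr_ge0 // ler0n.
Qed.

(** The Laplacian form vanishes for the eigenvalue [k], so [v] agrees across each edge, hence along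
    each path. *)
Lemma regular_eigenvector_const (v : T -> R) :
  connected_graph e -> (forall y, \sum_z (e y z)%:R * v z = k%:R * v y) ->
  forall x y, v x = v y.
Proof.
move=> conn eigv.
have edge y z : e y z -> v y = v z.
  have ge0 y' z' : 0 <= (e y' z')%:R * (v y' - v z') ^+ 2.
    by rewrite mulr_ge0 ?sqr_ge0 // ler0n.
  have := regular_laplacian eigv; rewrite subrr mulr0 mul0r => /eqP.
  rewrite psumr_eq0 => [/allP/(_ y (mem_index_enum _))/=|? _]; last first.
    exact: sumr_ge0.
  rewrite psumr_eq0 // => /allP/(_ z (mem_index_enum _))/= /[swap] ->.
  by rewrite mul1r sqrf_eq0 subr_eq0 => /eqP.
move=> x y; have /connectP[p + ->] := conn x y.
elim: p x => //= z p IHp x /andP[/edge -> /IHp]; exact.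
Qed.

End Laplacian.

(** * Ranks and entries of the idempotents *)

(** The row space of [E i] is the eigenspace: for [v] in the latter, computing [v *m A *m E j] in
    two ways kills [v *m E j] when [j != i], so [v = v *m E i]. *)
Lemma idempotent_rank (F : fieldType) (n d : nat) (A : 'M[F]_n)
    (theta : 'I_d.+1 -> F) (E : 'I_d.+1 -> 'M[F]_n) (i : 'I_d.+1) :
  injective theta -> \sum_j E j = 1%:M ->
  (forall j, E j *m A = theta j *: E j) ->
  (forall j, A *m E j = theta j *: E j) ->
  \rank (E i) = multiplicity A (theta i).
Proof.
move=> theta_inj sumE EA AE; apply/eqP; rewrite eqn_leq !mxrankS //.
  apply/rV_subP => v; rewrite -[v]mulmx1 -{2}sumE => /eigenspaceP vA.
  rewrite mulmx_sumr (bigD1 i) //= big1 ?addr0 ?submxMl // => j neq_ji.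
  have /eqP : (theta i - theta j) *: (v *m E j) = 0.
    rewrite scalerBl scalemxAl -[v in X in X - _]mulmx1 -vA mulmx1 -mulmxA AE.
    by rewrite -scalemxAr subrr.
  rewrite scaler_eq0 subr_eq0 (inj_eq theta_inj) eq_sym (negPf neq_ji).
  by move/eqP.
by apply/eigenspaceP; rewrite EA.
Qed.

(** [E] is the Gram matrix of its own rows, so [E x x + E y y - 2 * E x y] is the squared distance
    between two rows. *)
Lemma symm_idempotent_entry_le (R : realDomainType) (n : nat) (E : 'M[R]_n)
    (x y : 'I_n) :
  E^T = E -> E *m E = E -> E x x = E y y -> E x y <= E x x.
Proof.
move=> symE idE diagE.
have dot u v : E u v = \sum_z E u z * E v z.
  rewrite -[in LHS]idE mxE; apply: eq_bigr => z _.
  by rewrite -[in E z v]symE mxE.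
have : 0 <= \sum_z (E x z - E y z) ^+ 2 by apply: sumr_ge0 => z _; exact: sqr_ge0.
rewrite (_ : \sum_z _ = E x x + E y y - 2 * E x y); first by rewrite -diagE; lra.
rewrite (dot x x) (dot y y) (dot x y) mulr_sumr -big_split -sumrB.
by apply: eq_bigr => z _ /=; ring.
Qed.

(** * Signs of the products and averaging over odd indices *)

(** The negative factors are exactly the [i] ones with [k < i]. *)
Lemma prod_subr_decr (R : realDomainType) (d : nat) (theta : 'I_d.+1 -> R)
    (i : 'I_d.+1) :
  (forall i j : 'I_d.+1, (i < j)%N -> theta j < theta i) ->
  \prod_(k < d.+1 | k != i) (theta i - theta k) = (-1) ^+ i * pi_prod theta i.
Proof.
move=> decr.
have -> : (-1) ^+ i = \prod_(k < d.+1 | k != i) (-1) ^+ (k < i)%N :> R.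
  have iE : (i : nat) = (\sum_(k < i) 1)%N.
    by rewrite sum_nat_const card_ord muln1.
  rewrite -expr_sum; congr (_ ^+ _); rewrite [LHS]iE.
  rewrite (big_ord_widen _ (fun=> 1%N) (ltnW (ltn_ord i))).
  rewrite big_mkcond [RHS]big_mkcond; apply: eq_bigr => k _ /=.
  by have [->|] := eqVneq k i; rewrite ?ltnn //; case: ltnP.
rewrite -big_split; apply: eq_bigr => k neq_ki /=.
have := neq_ki; rewrite -val_eqE neq_ltn => /orP[lt_ki|lt_ik].
  by rewrite lt_ki mulN1r ltr0_norm ?opprK // subr_lt0 decr.
by rewrite ltnNge ltnW //= mul1r gtr0_norm // subr_gt0 decr.
Qed.

(** To be used with [w i] the ratio of [pi_prod theta ord0] to [pi_prod theta i], and [m i] the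
    multiplicity. The bounds for odd [i] add up to [n - So], so they cannot all fail. *)
Lemma odd_pigeonhole (R : realFieldType) (d : nat) (w m : 'I_d.+1 -> R) (n : R) :
  (forall i, 0 < w i) -> \sum_(i < d.+1) (-1) ^+ i * w i = 0 ->
  \sum_i m i = n -> (forall i : 'I_d.+1, ~~ odd i -> w i <= m i) ->
  exists i : 'I_d.+1, odd i /\ m i <= w i * (2 * n / \sum_j w j - 1).
Proof.
move=> w_gt0 alt_w sum_m le_wm; set S := \sum_j w j; set c := _ - 1.
have S_gt0 : 0 < S.
  rewrite /S (bigD1 ord0) //= ltr_pwDl //.
  by apply: sumr_ge0 => j _; exact: ltW.
pose So := \sum_(i < d.+1 | odd i) w i; pose Se := \sum_(i < d.+1 | ~~ odd i) w i.
have SE : S = So + Se by rewrite /S (bigID (fun i : 'I_d.+1 => odd i)).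
have SoSe : Se = So.
  apply/eqP; rewrite -subr_eq0 -{}alt_w.
  rewrite (bigID (fun i : 'I_d.+1 => odd i)) /= addrC -sumrN; apply/eqP.
  congr (_ + _); apply: eq_bigr => i; rewrite -signr_odd; case: (odd i) => // _.
    by rewrite mul1r.
  by rewrite mulN1r.
have [/existsP[i /andP[oi le_i]]|] := boolP [exists i : 'I_d.+1,
  odd i && (m i <= w i * c)]; first by exists i.
rewrite negb_exists => /forallP no_i; exfalso.
(* The strict comparison of sums needs a nonempty range; with no odd index, both equal halves of [S]
   would be zero. *)
have has_odd : has (fun i : 'I_d.+1 => odd i) (index_enum 'I_d.+1).
  apply: contraT => no_odd; move: S_gt0; rewrite SE SoSe /So big_hasC //.
  by rewrite addr0 ltxx.
have lt_odd : \sum_(i < d.+1 | odd i) w i * c < \sum_(i < d.+1 | odd i) m i.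
  apply: ltr_sum => // i oi; have := no_i i.
  by rewrite oi -ltNge.
have le_even : Se <= \sum_(i < d.+1 | ~~ odd i) m i by exact: ler_sum.
rewrite -mulr_suml -/So in lt_odd.
rewrite (bigID (fun i : 'I_d.+1 => odd i)) /= in sum_m.
have S2 : S = 2 * So by rewrite SE SoSe mulr_natl.
have So_gt0 : 0 < So by rewrite S2 in S_gt0; lra.
have cE : So * c = n - So by rewrite /c S2; field; exact: lt0r_neq0.
lra.
Qed.

(** * The largest eigenvalue of a regular graph and its idempotent *)

Section RegularSpectrum.
Variables (R : rcfType) (T : finType) (e : rel T).
Let A : 'M[R]_#|T| := adjmx R e.

Lemma adjmx_eigenvector (v : 'rV[R]_#|T|) (a : R) : symmetric e ->
  v *m A = a *: v ->
  forall y, \sum_z (e y z)%:R * v 0 (enum_rank z) = a * v 0 (enum_rank y).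
Proof.
move=> syme /matrixP/(_ 0) vA y; have := vA (enum_rank y).
rewrite !mxE sum_enum_rank => <-; apply: eq_bigr => z _.
by rewrite adjmxE syme mulrC.
Qed.

Lemma adjmx_sym : symmetric e -> A^T = A.
Proof. by move=> syme; apply/matrixP => i j; rewrite !mxE syme. Qed.

Lemma adjmx_regular (k : nat) : (forall y, #|[set z | e y z]| = k) ->
  A *m const_mx 1 = k%:R *: const_mx 1 :> 'cV_#|T|.
Proof.
move=> deg; apply/colP => i; rewrite -(enum_valK i) !mxE sum_enum_rank mulr1.
rewrite -(deg (enum_val i)) natr_card; apply: eq_bigr => z _.
by rewrite adjmxE !mxE mulr1.
Qed.

(** The valency bounds all eigenvalues and is one itself, through the all-ones vector; the vertex
    [x] makes that vector nonzero. *)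
Lemma regular_max_eigenvalue (k d : nat) (theta : 'I_d.+1 -> R) (x : T) :
  symmetric e -> (forall y, #|[set z | e y z]| = k) ->
  (forall a, eigenvalue A a <-> exists i, a = theta i) ->
  (forall i j : 'I_d.+1, (i < j)%N -> theta j < theta i) ->
  theta ord0 = k%:R.
Proof.
move=> syme deg spec decr; apply/eqP; rewrite eq_le; apply/andP; split.
  have /eigenvalueP[v vA v_neq0] : eigenvalue A (theta ord0).
    by apply/spec; exists ord0.
  apply: (regular_eigenvalue_le syme deg (adjmx_eigenvector syme vA)).
  have /rV0Pn[i vi] := v_neq0.
  by exists (enum_val i); rewrite enum_valK.
have /spec[i ->] : eigenvalue A k%:R.
  apply/eigenvalueP; exists (const_mx 1).
    have := congr1 trmx (adjmx_regular deg).
    by rewrite trmx_mul linearZ /= trmx_const adjmx_sym.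
  apply/rV0Pn; exists (enum_rank x); rewrite mxE; exact: oner_neq0.
have [->//|neq_i0] := eqVneq i ord0.
by rewrite ltW // decr // lt0n.
Qed.

(** The rows of [E ord0] are eigenvectors for [k], hence constant; as [E ord0] fixes the all-ones
    vector, each row sums to one. *)
Lemma principal_idempotent (k d : nat) (theta : 'I_d.+1 -> R)
    (E : 'I_d.+1 -> 'M[R]_#|T|) :
  symmetric e -> connected_graph e -> (forall y, #|[set z | e y z]| = k) ->
  theta ord0 = k%:R -> injective theta ->
  \sum_i E i = 1%:M -> (forall i, E i *m A = theta i *: E i) ->
  forall x y, #|T|%:R * E ord0 (enum_rank x) (enum_rank y) = 1.
Proof.
move=> syme conn deg theta0 theta_inj sumE EA x y.
pose u : 'cV[R]_#|T| := const_mx 1.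
have E0u : E ord0 *m u = u.
  rewrite -[RHS]mul1mx -sumE mulmx_suml (bigD1 ord0) //= big1 ?addr0 //.
  move=> i neq_i0; have /eqP : (theta ord0 - theta i) *: (E i *m u) = 0.
    rewrite scalerBl [X in _ - X]scalemxAl -EA -mulmxA (adjmx_regular deg).
    by rewrite -scalemxAr theta0 subrr.
  rewrite scaler_eq0 subr_eq0 (inj_eq theta_inj) eq_sym (negPf neq_i0).
  by move/eqP.
have rowE : row (enum_rank x) (E ord0) *m A
    = k%:R *: row (enum_rank x) (E ord0).
  by rewrite -row_mul EA theta0 linearZ.
have constE z : E ord0 (enum_rank x) (enum_rank z)
    = E ord0 (enum_rank x) (enum_rank y).
  have := regular_eigenvector_const syme deg conn
    (adjmx_eigenvector syme rowE) z y.
  by rewrite !mxE.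
have /colP/(_ (enum_rank x)) := E0u; rewrite !mxE sum_enum_rank => sum1.
rewrite -[RHS]sum1; under [RHS]eq_bigr do rewrite mxE mulr1 constE.
by rewrite sumr_const mulr_natl.
Qed.

End RegularSpectrum.

(** * Diameter and multiplicity bound *)

(* The diameter is at least d: otherwise the d.+1 powers A ^+ 0, ..., A ^+ d
   would lie in the span of d distance matrices, and A would be annihilated by
   a nonzero polynomial of degree at most d, which has too few roots. *)
Lemma drg_far_pair (R : fieldType) (T : finType) (e : rel T) (d : nat)
    (theta : 'I_d.+1 -> R) :
  distance_regular e -> (exists x y : T, e x y) -> injective theta ->
  (forall i, eigenvalue (adjmx R e) (theta i)) ->
  exists x y : T, x != y /\ (d <= gdist e x y)%N.
Proof.
move=> drg [x0 [y0 e0]] theta_inj eig.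
have [[_ irre] _ _] := drg.
have neq0 : x0 != y0 by apply: contraTneq e0 => ->; rewrite irre.
(* For [d = 0] the distance bound is void, and the given edge supplies distinct vertices. *)
have [->|d_gt0] := posnP d; first by exists x0, y0.
have [/existsP[x /existsP[y le_d]]|] :=
  boolP [exists x, exists y, (d <= gdist e x y)%N].
  exists x, y; split=> //; apply: contraTneq le_d => ->.
  by rewrite gdistxx -ltnNge.
move=> /existsPn near; exfalso.
have {}near x y : (gdist e x y < d)%N.
  by have /existsPn/(_ y) := near x; rewrite -ltnNge.
have [f fE] := adjmx_exp_gdist R drg.
(* Row [l] lists the entries of the [l]-th power by distance. With more rows than columns, [M] has a
   nonzero left kernel vector, the coefficients of the annihilating polynomial. *)
pose M : 'M[R]_(d.+1, d) := \matrix_(l, h) f l h.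
have : kermx M != 0.
  rewrite kermx_eq0 /row_free neq_ltn.
  by rewrite (leq_ltn_trans (rank_leq_col M)).
case/rowV0Pn => u /sub_kermxP uM /negP; apply.
have uA : \sum_(l < d.+1) u 0 l *: adjmx R e ^+ l = 0.
  apply/matrixP => i j; rewrite -(enum_valK i) -(enum_valK j) summxE.
  have /rowP/(_ (Ordinal (near (enum_val i) (enum_val j)))) := uM.
  rewrite !mxE => {2}<-; apply: eq_bigr => l _.
  by rewrite !mxE fE.
rewrite -(rVpolyK u) (_ : rVpoly u = 0) ?linear0 //.
apply: (@roots_geq_poly_eq0 _ _ (codom theta)).
- apply/allP => _ /codomP[i ->]; apply/rootP.
  have /eigenvalueP[v vA v_neq0] := eig i.
  have vAl l : v *m adjmx R e ^+ l = theta i ^+ l *: v.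
    elim: l => [|l IHl]; first by rewrite !expr0 mulmx1 scale1r.
    by rewrite exprSr mulmxA IHl -scalemxAl vA scalerA -exprSr.
  have /eqP := congr1 (mulmx v) uA; rewrite mulmx0 mulmx_sumr.
  under eq_bigr do rewrite -scalemxAr vAl scalerA.
  rewrite -scaler_suml scaler_eq0 (negPf v_neq0) orbF => /eqP <-.
  rewrite (horner_coef_wide _ (size_poly _ _)); apply: eq_bigr => l _.
  by rewrite coef_rVpoly_ord.
- by rewrite map_inj_uniq ?enum_uniq.
- by rewrite size_codom card_ord size_poly.
Qed.

Theorem corollary6p3 (R : rcfType) (T : finType) (e : rel T) (n d : nat)
    (theta : 'I_d.+1 -> R)
    (cardT : #|T| = n)
    (drg : distance_regular e)
    (has_edge : exists x y : T, e x y)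
    (spec : forall a : R,
        eigenvalue (adjmx R e) a <-> exists i : 'I_d.+1, a = theta i)
    (theta_decr : forall i j : 'I_d.+1, (i < j)%N -> theta j < theta i) :
  exists i : 'I_d.+1,
    [/\ odd i, (1 <= i <= d)%N &
        (multiplicity (adjmx R e) (theta i))%:R
          <= pi_prod theta ord0 / pi_prod theta i
             * (2 * n%:R
                  / (\sum_(j < d.+1) pi_prod theta ord0 / pi_prod theta j)
                - 1)].
Proof.
subst n; have theta_inj : injective theta.
  move=> i j eq_ij; apply/val_inj/eqP; rewrite eqn_leq leqNgt [X in _ && X]leqNgt.
  by apply/andP; split; apply/negP => /theta_decr; rewrite eq_ij ltxx.
have eig i : eigenvalue (adjmx R e) (theta i) by apply/spec; exists i.
have [x [y [neq_xy far]]] := drg_far_pair drg has_edge theta_inj eig.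
have [k deg] := drg_regular drg.
have [[syme _] conn _] := drg.
have symA := adjmx_sym R syme; set A := adjmx R e in eig symA *.
have theta0 := regular_max_eigenvalue x syme deg spec theta_decr.
have [E [sumE idE symE EA defE]] :=
  symm_spectral_decomposition symA theta_inj (fun a => proj1 (spec a)).
have AE i : A *m E i = theta i *: E i.
  by rewrite -[LHS]trmxK trmx_mul symE symA EA linearZ /= symE.
have E0 := principal_idempotent syme conn deg theta0 theta_inj sumE EA.
have n_gt0 : 0 < #|T|%:R :> R by rewrite ltr0n; apply/card_gt0P; exists x.
have pi_gt0 i : 0 < pi_prod theta i.
  apply: prodr_gt0 => j neq_ji.
  by rewrite normr_gt0 subr_eq0 (inj_eq theta_inj) eq_sym.
have Exy i : E i (enum_rank x) (enum_rank y)
    = (-1) ^+ i / pi_prod theta i * (A ^+ d) (enum_rank x) (enum_rank y).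
  rewrite defE summxE (bigD1 ord_max) //= big1 ?addr0 => [|l neq_l]; last first.
    rewrite mxE adjmx_exp_gdist_lt ?mulr0 // (leq_trans _ far) //.
    by rewrite ltn_neqAle -ltnS ltn_ord andbT.
  by rewrite mxE coef_lagrange prod_subr_decr // invfM invr_sign.
(* Obtained by comparing [Exy] at index 0 with [E0]. *)
have Adxy : (A ^+ d) (enum_rank x) (enum_rank y) = pi_prod theta ord0 / #|T|%:R.
  have := E0 x y; rewrite Exy expr0 => E0xy.
  rewrite -[RHS]mul1r -[X in X * _]E0xy; field.
  by rewrite !lt0r_neq0.
(* The diagonal of [E i] is constant since each power of [A] has a constant diagonal; its sum is the
   trace, hence the rank. *)
have diagE i z : #|T|%:R * E i (enum_rank z) (enum_rank z)
    = (multiplicity A (theta i))%:R.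
  rewrite -(idempotent_rank i theta_inj sumE EA AE) -mxtrace_idempotent //.
  have [f fE] := adjmx_exp_gdist R drg.
  have diag_const z' : E i (enum_rank z') (enum_rank z')
      = E i (enum_rank z) (enum_rank z).
    rewrite defE !summxE; apply: eq_bigr => l _.
    by rewrite !mxE !fE !gdistxx.
  rewrite /mxtrace sum_enum_rank; under [RHS]eq_bigr do rewrite diag_const.
  by rewrite sumr_const mulr_natl.
pose w i := pi_prod theta ord0 / pi_prod theta i.
have Exyw i : #|T|%:R * E i (enum_rank x) (enum_rank y) = (-1) ^+ i * w i.
  rewrite Exy Adxy /w; field.
  by rewrite !lt0r_neq0.
have [|||i0 even_i|i [odd_i le_i]] :=
  @odd_pigeonhole R d w (fun i => (multiplicity A (theta i))%:R) #|T|%:R.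
- by move=> i; rewrite /w divr_gt0.
(* The alternating sum is [#|T|] times an off-diagonal entry of the identity matrix. *)
- under eq_bigr do rewrite -Exyw.
  rewrite -mulr_sumr -summxE sumE mxE (inj_eq enum_rank_inj) (negPf neq_xy).
  exact: mulr0.
- rewrite -(mxtrace1 R #|T|) -sumE linear_sum; apply: eq_bigr => i _.
  by rewrite -(idempotent_rank i theta_inj sumE EA AE) -mxtrace_idempotent.
- have := symm_idempotent_entry_le (symE i0) (idE i0).
  move=> /(_ (enum_rank x) (enum_rank y)).
  have eqd : E i0 (enum_rank x) (enum_rank x) = E i0 (enum_rank y) (enum_rank y).
    by apply: (mulfI (lt0r_neq0 n_gt0)); rewrite !diagE.
  move=> /(_ eqd); rewrite -(ler_pM2l n_gt0) Exyw diagE -signr_odd.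
  by rewrite (negPf even_i) mul1r.
exists i; split=> //; rewrite (odd_gt0 odd_i) /=; exact: leq_ord.
Qed.
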